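(* The following are timelike Riemann ZMC examples in $\mathbb{L}^3$ foliated by (pieces of) circles contained in spacelike planes, parametrized by elementary functions (case $\lambda=-2$): (1) For any $r_0>1$, the surface $$X(r,v)=\left(-r-\tfrac12\log\tfrac{r-1}{r+1},0,\tfrac12\log\tfrac{r-1}{r+1}\right)+r(\cos v,\sin v,0),\qquad r\in[r_0,\infty),\ 1-\tfrac{2}{r^2}<\cos v<1.$$ (2) The surface $$X(r,v)=(r-\operatorname{artanh} r,0,\operatorname{artanh} r)+r(\cos v,\sin v,0),\qquad r\in(0,1),\ v\in(-\pi,\pi).$$ This surface extends to a lightlike straight line by considering the points with $\cos v=-1$. It is included in the halfspace $x_3>0$, with $\lim_{r\to1}x_3=\infty$.
   Context: $\mathbb{L}^3$ is $\mathbb{R}^3$ with the metric $\langle,\rangle=dx_1^2+dx_2^2-dx_3^2$. A surface is spacelike, timelike or lightlike (degenerate) at a point if the induced metric there is Riemannian, Lorentzian or degenerate; a straight line is lightlike if its direction $\vec v\ne0$ satisfies $\langle\vec v,\vec v\rangle=0$. The mean curvature $H$ is the trace of the second fundamental form; ZMC means $H=0$. Circles in planes $x_3=\text{const}$ are Euclidean circles. A Riemann ZMC example is a non-rotational surface with zero mean curvature foliated by pieces of circles contained in parallel planes. The parameter $\lambda$ labels members of the family $X(q,v)=(-m(q),0,z(q))+\sqrt q(\cos v,\sin v,0)$ with $z'(q)=\frac{1}{2\sqrt{q^3+\lambda q^2+q}}$, $m'(q)=\frac{q}{2\sqrt{q^3+\lambda q^2+q}}$, and $r=\sqrt q$. ''Extends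 to a lightlike straight line'' means that the adjoined points are points where the metric is degenerate and lie on a lightlike straight line. *)

(* Defs.v *)
From Stdlib Require Import Reals.
From Coquelicot Require Import Coquelicot.
Open Scope R_scope.

Definition L3 : Type := (R * R * R)%type.
Definition x1 (p : L3) : R := fst (fst p).
Definition x2 (p : L3) : R := snd (fst p).
Definition x3 (p : L3) : R := snd p.

Definition zero3 : L3 := (0, 0, 0).
Definition add3 (p q : L3) : L3 := (x1 p + x1 q, x2 p + x2 q, x3 p + x3 q).
Definition scal3 (a : R) (p : L3) : L3 := (a * x1 p, a * x2 p, a * x3 p).
Definition sub3 (p q : L3) : L3 := add3 p (scal3 (-1) q).

Definition inner (p q : L3) : R := x1 p * x1 q + x2 p * x2 q - x3 p * x3 q.

(** Lorentzian cross product: [inner (cross p q) w = det (p, q, w)]. *)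
Definition cross (p q : L3) : L3 :=
  (x2 p * x3 q - x3 p * x2 q,
   x3 p * x1 q - x1 p * x3 q,
   x2 p * x1 q - x1 p * x2 q).

Definition line (p0 w p : L3) : Prop := exists t : R, p = add3 p0 (scal3 t w).

Definition lightlike (w : L3) : Prop := w <> zero3 /\ inner w w = 0.

(** A surface is the restriction of a map [X : R -> R -> L3] to a set [D] of
    parameters; the values of [X] outside a neighbourhood of [D] are irrelevant. *)

Definition d_u (X : R -> R -> L3) (u v : R) : L3 :=
  (Derive (fun t => x1 (X t v)) u,
   Derive (fun t => x2 (X t v)) u,
   Derive (fun t => x3 (X t v)) u).

Definition d_v (X : R -> R -> L3) (u v : R) : L3 :=
  (Derive (fun t => x1 (X u t)) v,
   Derive (fun t => x2 (X u t)) v,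
   Derive (fun t => x3 (X u t)) v).

Definition smooth_fun_at (f : R -> R -> R) (u v : R) : Prop :=
  locally_2d (fun a b => forall n : nat, ex_diff_n f n a b) u v.

Definition smooth_at (X : R -> R -> L3) (u v : R) : Prop :=
  smooth_fun_at (fun a b => x1 (X a b)) u v /\
  smooth_fun_at (fun a b => x2 (X a b)) u v /\
  smooth_fun_at (fun a b => x3 (X a b)) u v.

Definition regular_at (X : R -> R -> L3) (u v : R) : Prop :=
  forall a b : R,
    add3 (scal3 a (d_u X u v)) (scal3 b (d_v X u v)) = zero3 -> a = 0 /\ b = 0.

Definition smooth_surface (X : R -> R -> L3) (D : R -> R -> Prop) : Prop :=
  forall u v, D u v -> smooth_at X u v /\ regular_at X u v.

Definition image (X : R -> R -> L3) (D : R -> R -> Prop) (p : L3) : Prop :=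
  exists u v, D u v /\ p = X u v.

Definition tangent (X : R -> R -> L3) (u v : R) (w : L3) : Prop :=
  exists a b : R, w = add3 (scal3 a (d_u X u v)) (scal3 b (d_v X u v)).

(** Signature (1,1): an orthogonal basis with one positive and one negative vector. *)
Definition timelike_at (X : R -> R -> L3) (u v : R) : Prop :=
  exists e1 e2 : L3,
    tangent X u v e1 /\ tangent X u v e2 /\
    inner e1 e2 = 0 /\ 0 < inner e1 e1 /\ inner e2 e2 < 0.

Definition degenerate_at (X : R -> R -> L3) (u v : R) : Prop :=
  exists w : L3,
    tangent X u v w /\ w <> zero3 /\
    forall w' : L3, tangent X u v w' -> inner w w' = 0.

Definition unit_normal (X : R -> R -> L3) (u v : R) : L3 :=
  let n := cross (d_u X u v) (d_v X u v) in
  scal3 (/ sqrt (Rabs (inner n n))) n.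

(** Trace, with respect to the induced metric, of the second fundamental form
    [<X_ij, N>].  It is meaningful where the metric is nondegenerate.  The sign
    [<N,N>] in front of it, present in some conventions, does not affect [H = 0]. *)
Definition mean_curvature (X : R -> R -> L3) (u v : R) : R :=
  let N := unit_normal X u v in
  let g11 := inner (d_u X u v) (d_u X u v) in
  let g12 := inner (d_u X u v) (d_v X u v) in
  let g22 := inner (d_v X u v) (d_v X u v) in
  let h11 := inner (d_u (d_u X) u v) N in
  let h12 := inner (d_v (d_u X) u v) N in
  let h22 := inner (d_v (d_v X) u v) N in
  (g22 * h11 - 2 * g12 * h12 + g11 * h22) / (g11 * g22 - g12 * g12).

Definition isometry (phi : L3 -> L3) : Prop :=
  forall p q : L3,
    inner (sub3 (phi p) (phi q)) (sub3 (phi p) (phi q)) =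
    inner (sub3 p q) (sub3 p q).

Definition rotation_group (phi : R -> L3 -> L3) : Prop :=
  (forall p, phi 0 p = p) /\
  (forall s t p, phi (s + t) p = phi s (phi t p)) /\
  (forall t, isometry (phi t)) /\
  (forall t p, ex_derive (fun s => x1 (phi s p)) t /\
               ex_derive (fun s => x2 (phi s p)) t /\
               ex_derive (fun s => x3 (phi s p)) t) /\
  (exists a w : L3, w <> zero3 /\
     forall t p, line a w p -> phi t p = p) /\
  (exists t p, phi t p <> p).

(** Pieces of invariant surfaces count as rotational: the invariance is local
    and is only asked at interior parameters, because an orbit may leave the
    piece through its boundary. *)
Definition rotational (X : R -> R -> L3) (D : R -> R -> Prop) : Prop :=
  exists phi : R -> L3 -> L3,
    rotation_group phi /\
    forall u v, locally_2d D u v ->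
      exists eps : posreal,
        forall t, Rabs t < eps -> image X D (phi t (X u v)).

(** The planes [<n, p> = h] are spacelike. *)
Definition spacelike_planes (n : L3) : Prop :=
  forall p : L3, p <> zero3 -> inner n p = 0 -> 0 < inner p p.

(** The metric restricted to a spacelike plane is Euclidean; in planes
    [x3 = const] these are the usual Euclidean circles. *)
Definition circle (n : L3) (h : R) (c : L3) (rho : R) (p : L3) : Prop :=
  inner n p = h /\ inner (sub3 p c) (sub3 p c) = rho * rho.

Definition open_in (C S : L3 -> Prop) : Prop :=
  forall p, S p ->
    exists eps : posreal, forall q, C q ->
      Rabs (x1 q - x1 p) < eps -> Rabs (x2 q - x2 p) < eps ->
      Rabs (x3 q - x3 p) < eps -> S q.

(** A nonempty set which is a union of open arcs of one circle. *)
Definition circle_piece (n : L3) (h : R) (S : L3 -> Prop) : Prop :=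
  (exists p, S p) /\
  exists (c : L3) (rho : R),
    inner n c = h /\ 0 < rho /\
    (forall p, S p -> circle n h c rho p) /\
    open_in (circle n h c rho) S.

Definition foliated_by_circles_in_spacelike_planes (S : L3 -> Prop) : Prop :=
  exists n : L3, spacelike_planes n /\
    forall h : R, (exists p, S p /\ inner n p = h) ->
      circle_piece n h (fun p => S p /\ inner n p = h).

Definition timelike_riemann_zmc_spacelike_planes
    (X : R -> R -> L3) (D : R -> R -> Prop) : Prop :=
  smooth_surface X D /\
  (forall u v, D u v -> timelike_at X u v) /\
  (forall u v, D u v -> mean_curvature X u v = 0) /\
  ~ rotational X D /\
  foliated_by_circles_in_spacelike_planes (image X D).

(** [X (r, v)], with [r = sqrt q], is the member of parameter [lambda] of the
    family [(-m(q), 0, z(q)) + sqrt q (cos v, sin v, 0)]. *)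
Definition riemann_family_member (lambda : R)
    (X : R -> R -> L3) (D : R -> R -> Prop) : Prop :=
  exists m z : R -> R,
    forall r v, D r v ->
      let q := r ^ 2 in
      let P := q ^ 3 + lambda * q ^ 2 + q in
      0 < r /\ 0 < P /\
      is_derive z q (1 / (2 * sqrt P)) /\
      is_derive m q (q / (2 * sqrt P)) /\
      X r v = add3 (- m q, 0, z q) (scal3 (sqrt q) (cos v, sin v, 0)).

(** The map [X] on [D] extends to the parameters in [A] as a smooth surface,
    the adjoined points being degenerate and lying on a lightlike line. *)
Definition extends_to_lightlike_line
    (X : R -> R -> L3) (D A : R -> R -> Prop) : Prop :=
  smooth_surface X (fun u v => D u v \/ A u v) /\
  (forall u v, A u v -> degenerate_at X u v) /\
  exists p0 w : L3, lightlike w /\ forall u v, A u v -> line p0 w (X u v).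

Definition artanh (x : R) : R := / 2 * ln ((1 + x) / (1 - x)).

Definition X_outer (r v : R) : L3 :=
  add3 (- r - / 2 * ln ((r - 1) / (r + 1)), 0, / 2 * ln ((r - 1) / (r + 1)))
       (scal3 r (cos v, sin v, 0)).

Definition D_outer (r0 r v : R) : Prop :=
  r0 <= r /\ 1 - 2 / r ^ 2 < cos v < 1.

Definition X_inner (r v : R) : L3 :=
  add3 (r - artanh r, 0, artanh r) (scal3 r (cos v, sin v, 0)).

Definition D_inner (r v : R) : Prop := 0 < r < 1 /\ - PI < v < PI.

Definition A_inner (r v : R) : Prop := 0 < r < 1 /\ - PI <= v <= PI /\ cos v = -1.

(* Main.v *)
(** Both surfaces are unions of the circles of radius [r] centred at [(c r, 0, z r)] with
    [c r = sigma r - z r], [z' = sigma / (1 - r^2)] and [e^(2 z) = (sigma + r) / (1 - sigma r)],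
    where [sigma = 1] for the inner and [sigma = -1] for the outer one; the metric and curvature
    claims are then identities between rational functions of [r], [cos v], [sin v].

    A rotation group leaving the surface locally invariant has as velocity field an affine
    Killing field [K], tangent to the surface.  Differentiating an implicit equation of the
    surface turns tangency into
    [cos v (K1 + K3) + sin v K2 - (1 - r^2) (sigma + cos v) K3 = 0],
    a trigonometric polynomial in [v] whose coefficients force [K = 0], so that the group is
    trivial: the surface has no infinitesimal symmetry at all. *)
Require Import Defs.
From Stdlib Require Import Reals Lra FunctionalExtensionality.
From Coquelicot Require Import Coquelicot.
Open Scope R_scope.

(** * Surfaces of circles over a profile curve *)

(** [X_outer] and [X_inner] are both convertible to instances of [circular], so general lemmas apply
    to them directly. *)
Definition circular (c z : R -> R) (r v : R) : L3 :=
  add3 (c r, 0, z r) (scal3 r (cos v, sin v, 0)).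

(** [profile_side] makes [sigma * (1 - r ^ 2)] the absolute value of [1 - r ^ 2]. [profile_exp] is
    the integrated form of [profile_derive] with the constant of integration fixed; it turns
    questions about [z] into algebra in [r]. [profile_center] is asked for all [r], so that [c] can
    be rewritten as a function. *)
Record riemann_profile (sigma : R) (I : R -> Prop) (c z : R -> R) : Prop := {
  profile_sign : sigma = 1 \/ sigma = -1;
  profile_open : forall r, I r -> locally r I;
  profile_pos : forall r, I r -> 0 < r;
  profile_side : forall r, I r -> 0 < sigma * (1 - r ^ 2);
  profile_center : forall r, c r = sigma * r - z r;
  profile_derive : forall r, I r -> is_derive z r (sigma / (1 - r ^ 2));
  profile_exp : forall r, I r -> exp (2 * z r) * (1 - sigma * r) = sigma + r }.

Arguments profile_sign {sigma I c z}.
Arguments profile_open {sigma I c z}.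
Arguments profile_pos {sigma I c z}.
Arguments profile_side {sigma I c z}.
Arguments profile_center {sigma I c z}.
Arguments profile_derive {sigma I c z}.
Arguments profile_exp {sigma I c z}.

Local Ltac nonzero N := intro; apply N; lra.

Lemma profile_nonzero sigma I c z (H : riemann_profile sigma I c z) r :
  I r -> 1 - r ^ 2 <> 0.
Proof.
  intros Ir E. pose proof (profile_side H r Ir) as S. rewrite E in S. lra.
Qed.

Lemma profile_center_derive sigma I c z (H : riemann_profile sigma I c z) r :
  I r -> is_derive c r (- sigma * r ^ 2 / (1 - r ^ 2)).
Proof.
  intros Ir. pose proof (profile_nonzero _ _ _ _ H r Ir) as N.
  apply is_derive_ext with (fun t => sigma * t - z t).
  - intros t. symmetry. apply (profile_center H).
  - auto_derive.
    + eexists. apply (profile_derive H r Ir).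
    + replace (Derive (fun x => z x) r) with (sigma / (1 - r ^ 2)).
      * field. nonzero N.
      * symmetry. apply is_derive_unique, (profile_derive H r Ir).
Qed.

(** * Smoothness of the parametrization *)

Lemma locally_2d_fst (I : R -> Prop) (u v : R) :
  locally u I -> locally_2d (fun a _ => I a) u v.
Proof.
  intros [eps He]. exists eps. intros a b Ha _. apply He. exact Ha.
Qed.

(** An algebra of functions that is closed under both partial derivatives. *)
Inductive elementary (z : R -> R) : (R -> R -> R) -> Prop :=
| el_const a : elementary z (fun _ _ => a)
| el_fst : elementary z (fun u _ => u)
| el_profile : elementary z (fun u _ => z u)
| el_inv : elementary z (fun u _ => / (1 - u ^ 2))
| el_cos : elementary z (fun _ v => cos v)
| el_sin : elementary z (fun _ v => sin v)
| el_plus f g : elementary z f -> elementary z g ->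
    elementary z (fun u v => f u v + g u v)
| el_mult f g : elementary z f -> elementary z g ->
    elementary z (fun u v => f u v * g u v).

(** By induction on the construction of [f]. The generators suffice because
    [z' = sigma / (1 - u ^ 2)], and the derivative of [/ (1 - u ^ 2)] is [2 * u] times its
    square. *)
Lemma elementary_partials sigma I c z f :
  riemann_profile sigma I c z -> elementary z f ->
  exists fu fv, elementary z fu /\ elementary z fv /\
    forall u v, I u ->
      continuity_2d_pt f u v /\
      is_derive (fun t => f t v) u (fu u v) /\
      is_derive (fun t => f u t) v (fv u v).
Proof.
  intros H. induction 1 as
    [ a | | | | | | f g _ (fu & fv & Efu & Efv & Hf) _ (gu & gv & Egu & Egv & Hg)
    | f g Ef (fu & fv & Efu & Efv & Hf) Eg (gu & gv & Egu & Egv & Hg) ].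
  - exists (fun _ _ => 0), (fun _ _ => 0).
    split; [constructor|split; [constructor|]]. intros u v Iu.
    split; [apply continuity_2d_pt_const|]. split; auto_derive; trivial.
  - exists (fun _ _ => 1), (fun _ _ => 0).
    split; [constructor|split; [constructor|]]. intros u v Iu.
    split; [apply continuity_2d_pt_id1|]. split; auto_derive; trivial.
  - exists (fun u v => sigma * / (1 - u ^ 2)), (fun _ _ => 0).
    split; [apply (el_mult z (fun _ _ => sigma)); constructor|split; [constructor|]].
    intros u v Iu. pose proof (profile_derive H u Iu) as D.
    split; [|split; [exact D|auto_derive; trivial]].
    apply (continuity_1d_2d_pt_comp z (fun u _ => u)).
    + apply continuity_pt_filterlim. apply (ex_derive_continuous z u). eexists. exact D.
    + apply continuity_2d_pt_id1.
  - exists (fun u v => (2 * u) * (/ (1 - u ^ 2) * / (1 - u ^ 2))), (fun _ _ => 0).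
    split; [|split; [constructor|]].
    + apply (el_mult z (fun u _ => 2 * u) (fun u _ => / (1 - u ^ 2) * / (1 - u ^ 2))).
      * apply (el_mult z (fun _ _ => 2)); constructor.
      * apply (el_mult z (fun u _ => / (1 - u ^ 2))); constructor.
    + intros u v Iu. pose proof (profile_nonzero _ _ _ _ H u Iu) as N.
      split; [|split; auto_derive; trivial; field; nonzero N].
      apply (continuity_1d_2d_pt_comp (fun u => / (1 - u ^ 2)) (fun u _ => u)).
      * apply continuity_pt_filterlim. apply (ex_derive_continuous (fun u => / (1 - u ^ 2)) u).
        auto_derive. exact N.
      * apply continuity_2d_pt_id1.
  - exists (fun _ _ => 0), (fun _ v => (-1) * sin v).
    split; [constructor|split; [apply (el_mult z (fun _ _ => -1)); constructor|]].
    intros u v Iu. split; [|split; auto_derive; trivial; ring].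
    apply (continuity_1d_2d_pt_comp cos (fun _ v => v)); [apply continuity_cos|].
    apply continuity_2d_pt_id2.
  - exists (fun _ _ => 0), (fun _ v => cos v).
    split; [constructor|split; [constructor|]].
    intros u v Iu. split; [|split; auto_derive; trivial; ring].
    apply (continuity_1d_2d_pt_comp sin (fun _ v => v)); [apply continuity_sin|].
    apply continuity_2d_pt_id2.
  - exists (fun u v => fu u v + gu u v), (fun u v => fv u v + gv u v).
    split; [apply el_plus; assumption|split; [apply el_plus; assumption|]].
    intros u v Iu. destruct (Hf u v Iu) as (Cf & Fu & Fv), (Hg u v Iu) as (Cg & Gu & Gv).
    split; [apply continuity_2d_pt_plus; assumption|].
    split.
    + apply (is_derive_plus (fun t => f t v) (fun t => g t v)); assumption.
    + apply (is_derive_plus (fun t => f u t) (fun t => g u t)); assumption.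
  - exists (fun u v => fu u v * g u v + f u v * gu u v),
      (fun u v => fv u v * g u v + f u v * gv u v).
    split; [|split].
    + apply (el_plus z (fun u v => fu u v * g u v)); apply el_mult; assumption.
    + apply (el_plus z (fun u v => fv u v * g u v)); apply el_mult; assumption.
    + intros u v Iu. destruct (Hf u v Iu) as (Cf & Fu & Fv), (Hg u v Iu) as (Cg & Gu & Gv).
      split; [apply continuity_2d_pt_mult; assumption|].
      split.
      * apply (is_derive_mult (fun t => f t v) (fun t => g t v)); trivial. exact Rmult_comm.
      * apply (is_derive_mult (fun t => f u t) (fun t => g u t)); trivial. exact Rmult_comm.
Qed.

(** Induction on the order of differentiation, the partials being elementary again. [Derive] is
    known to agree with them on [I] only, and openness of [I] makes this a local equality. *)
Lemma elementary_smooth sigma I c z f u v :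
  riemann_profile sigma I c z -> elementary z f -> I u -> smooth_fun_at f u v.
Proof.
  intros H Ef Iu.
  assert (A : forall n f u v, elementary z f -> I u -> ex_diff_n f n u v).
  { clear f u v Ef Iu. induction n as [|n IH]; intros f u v Ef Iu;
      destruct (elementary_partials _ _ _ _ _ H Ef) as (fu & fv & Efu & Efv & Hf);
      destruct (Hf u v Iu) as (Cf & Fu & Fv).
    - split; trivial.
    - split; [exact Cf|]. split; [eexists; exact Fu|]. split; [eexists; exact Fv|].
      split.
      + apply ex_diff_n_ext_loc with fu; [|apply IH; assumption].
        apply (locally_2d_impl (fun a _ => I a)).
        * apply locally_2d_forall. intros a b Ia. symmetry.
          apply is_derive_unique, (Hf a b Ia).
        * apply locally_2d_fst, (profile_open H), Iu.
      + apply ex_diff_n_ext_loc with fv; [|apply IH; assumption].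
        apply (locally_2d_impl (fun a _ => I a)).
        * apply locally_2d_forall. intros a b Ia. symmetry.
          apply is_derive_unique, (Hf a b Ia).
        * apply locally_2d_fst, (profile_open H), Iu. }
  apply (locally_2d_impl (fun a _ => I a)).
  - apply locally_2d_forall. intros a b Ia n. apply A; assumption.
  - apply locally_2d_fst, (profile_open H), Iu.
Qed.

Lemma circular_smooth sigma I c z (H : riemann_profile sigma I c z) r v :
  I r -> smooth_at (circular c z) r v.
Proof.
  intros Ir.
  assert (P : elementary z (fun a b => c a + a * cos b)).
  (* [c] is not a generator of [elementary], so it is eliminated through [profile_center]. *)
  { replace (fun a b => c a + a * cos b)
      with (fun a b => (sigma * a + (-1) * z a) + a * cos b).
    - apply (el_plus z (fun a _ => sigma * a + (-1) * z a) (fun a b => a * cos b)).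
      + apply (el_plus z (fun a _ => sigma * a) (fun a _ => (-1) * z a)).
        * apply (el_mult z (fun _ _ => sigma)); constructor.
        * apply (el_mult z (fun _ _ => -1)); constructor.
      + apply (el_mult z (fun a _ => a)); constructor.
    - extensionality a; extensionality b. rewrite (profile_center H a). ring. }
  split; [|split]; apply (elementary_smooth sigma I c z); try assumption; simpl.
  - apply (el_plus z (fun _ _ => 0) (fun a b => a * sin b)); [constructor|].
    apply (el_mult z (fun a _ => a)); constructor.
  - apply (el_plus z (fun a _ => z a) (fun a b => a * 0)); [constructor|].
    apply (el_mult z (fun a _ => a) (fun _ _ => 0)); constructor.
Qed.

(** * First and second partial derivatives *)

Lemma L3_eq (a b c a' b' c' : R) :
  a = a' -> b = b' -> c = c' -> (a, b, c) = (a', b', c') :> L3.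
Proof. intros -> -> ->. reflexivity. Qed.

Lemma circular_d_v c z r v :
  d_v (circular c z) r v = (- r * sin v, r * cos v, 0).
Proof.
  apply L3_eq; unfold x1, x2, x3, circular; cbn;
    apply is_derive_unique; auto_derive; trivial; ring.
Qed.

Lemma circular_d_vv c z r v :
  d_v (d_v (circular c z)) r v = (- r * cos v, - r * sin v, 0).
Proof.
  replace (d_v (circular c z)) with (fun r v => (- r * sin v, r * cos v, 0) : L3)
    by (extensionality a; extensionality b; symmetry; apply circular_d_v).
  apply L3_eq; unfold x1, x2, x3; cbn; apply is_derive_unique; auto_derive; trivial; ring.
Qed.

Lemma circular_d_u sigma I c z (H : riemann_profile sigma I c z) r v :
  I r ->
  d_u (circular c z) r v =
  (- sigma * r ^ 2 / (1 - r ^ 2) + cos v, sin v, sigma / (1 - r ^ 2)).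
Proof.
  intros Ir. pose proof (profile_nonzero _ _ _ _ H r Ir) as N.
  pose proof (profile_center_derive _ _ _ _ H r Ir) as Dc.
  pose proof (profile_derive H r Ir) as Dz.
  apply L3_eq; unfold x1, x2, x3, circular; cbn; apply is_derive_unique.
  - auto_derive; [eexists; exact Dc|].
    change (fun x => c x) with c. rewrite (is_derive_unique _ _ _ Dc). field. nonzero N.
  - auto_derive; trivial. ring.
  - auto_derive; [eexists; exact Dz|].
    change (fun x => z x) with z. rewrite (is_derive_unique _ _ _ Dz). field. nonzero N.
Qed.

(** The formula of [circular_d_u] holds on [I] only, so each component is differentiated after a
    local replacement near [r]. *)
Lemma circular_d_uu sigma I c z (H : riemann_profile sigma I c z) r v :
  I r ->
  d_u (d_u (circular c z)) r v =
  (- sigma * (2 * r) / (1 - r ^ 2) ^ 2, 0, sigma * (2 * r) / (1 - r ^ 2) ^ 2).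
Proof.
  intros Ir. pose proof (profile_nonzero _ _ _ _ H r Ir) as N.
  apply L3_eq; unfold x1, x2, x3;
  [ rewrite (Derive_ext_loc _ (fun r => - sigma * r ^ 2 / (1 - r ^ 2) + cos v))
  | rewrite (Derive_ext_loc _ (fun r => sin v))
  | rewrite (Derive_ext_loc _ (fun r => sigma / (1 - r ^ 2))) ];
  try (apply is_derive_unique; auto_derive; trivial; field; nonzero N).
  all: apply (filter_imp I); [|apply (profile_open H), Ir];
    intros t It; rewrite (circular_d_u _ _ _ _ H t v It); reflexivity.
Qed.

Lemma circular_d_uv sigma I c z (H : riemann_profile sigma I c z) r v :
  I r -> d_v (d_u (circular c z)) r v = (- sin v, cos v, 0).
Proof.
  intros Ir.
  assert (E : d_u (circular c z) r = fun v =>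
    (- sigma * r ^ 2 / (1 - r ^ 2) + cos v, sin v, sigma / (1 - r ^ 2)))
    by (extensionality b; apply (circular_d_u _ _ _ _ H), Ir).
  unfold d_v. rewrite E.
  apply L3_eq; unfold x1, x2, x3; cbn; apply is_derive_unique; auto_derive; trivial; ring.
Qed.

(** * Regularity, mean curvature and causal character *)

Lemma cos_sq v : cos v * cos v = 1 - sin v * sin v.
Proof. pose proof (sin2_cos2 v) as E. unfold Rsqr in E. lra. Qed.

(** The third component of [d_u] never vanishes and that of [d_v] is zero, which forces [a = 0].
    What remains is [b] times a vector of Euclidean length [r > 0]. *)
Lemma circular_regular sigma I c z (H : riemann_profile sigma I c z) r v :
  I r -> regular_at (circular c z) r v.
Proof.
  intros Ir a b.
  pose proof (profile_nonzero _ _ _ _ H r Ir) as N. pose proof (profile_pos H r Ir) as P.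
  rewrite (circular_d_u _ _ _ _ H r v Ir), circular_d_v.
  unfold add3, scal3, zero3, x1, x2, x3; cbn. intros E. injection E as E1 E2 E3.
  assert (A : a = 0).
  { assert (S : sigma <> 0) by (destruct (profile_sign H); lra).
    assert (Q : sigma / (1 - r * (r * 1)) <> 0).
    { apply Rmult_integral_contrapositive. split; [exact S|]. apply Rinv_neq_0_compat, N. }
    apply Rmult_eq_reg_r with (2 := Q). lra. }
  split; [exact A|]. subst a.
  pose proof (cos_sq v) as C.
  assert (F : b * r = 0).
  { replace (b * r) with (b * r * (cos v * cos v + sin v * sin v)) by (rewrite C; ring).
    replace (b * r * (cos v * cos v + sin v * sin v)) with
      ((b * (r * cos v)) * cos v - (b * (- r * sin v)) * sin v) by ring.
    replace (b * (r * cos v)) with 0 by lra.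
    replace (b * (- r * sin v)) with 0 by lra. ring. }
  nra.
Qed.

Lemma circular_zmc sigma I c z (H : riemann_profile sigma I c z) r v :
  I r -> mean_curvature (circular c z) r v = 0.
Proof.
  intros Ir. pose proof (profile_nonzero _ _ _ _ H r Ir) as N.
  unfold mean_curvature, unit_normal.
  rewrite (circular_d_uu _ _ _ _ H r v Ir), (circular_d_uv _ _ _ _ H r v Ir), circular_d_vv,
    (circular_d_u _ _ _ _ H r v Ir), circular_d_v.
  (* The numerator of the mean curvature is linear in the normal, so the normalizing factor may be
     any [k]; once the numerator vanishes, so does the quotient. *)
  match goal with |- context [scal3 ?k _] => generalize k end. intros k.
  match goal with |- ?a / _ = 0 => replace a with 0; [unfold Rdiv; ring|] end.
  unfold cross, inner, scal3, x1, x2, x3; cbn [fst snd].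
  assert (Q : sin v ^ 2 = 1 - cos v ^ 2) by (pose proof (cos_sq v); lra).
  destruct (profile_sign H) as [-> | ->]; field [Q]; nonzero N.
Qed.

(** The determinant of the induced metric is [r^2 (W^2 - 1) / (1 - r^2)^2] with
    [W = 1 - r^2 - sigma r^2 cos v]. *)
Lemma circular_timelike sigma I c z (H : riemann_profile sigma I c z) r v :
  I r -> -1 < 1 - r ^ 2 - sigma * r ^ 2 * cos v < 1 ->
  timelike_at (circular c z) r v.
Proof.
  intros Ir W. pose proof (profile_nonzero _ _ _ _ H r Ir) as N.
  pose proof (profile_pos H r Ir) as P.
  set (m := - sigma * r ^ 2 / (1 - r ^ 2)).
  (* Gram-Schmidt: [d_v] has square [r ^ 2] and product [- r * m * sin v] with [d_u], where [m] is
     the derivative of [c]. The second vector is [d_u] minus its component along [d_v]; its square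
     is the metric determinant divided by [r ^ 2]. *)
  exists (d_v (circular c z) r v),
    (add3 (scal3 1 (d_u (circular c z) r v)) (scal3 (m * sin v / r) (d_v (circular c z) r v))).
  split; [|split; [|split; [|split]]].
  - exists 0, 1. unfold add3, scal3. rewrite circular_d_v. apply L3_eq; cbn; ring.
  - eexists; eexists; reflexivity.
  - rewrite (circular_d_u _ _ _ _ H r v Ir), circular_d_v. fold m.
    unfold inner, add3, scal3, x1, x2, x3; cbn. field [(cos_sq v)]. lra.
  - rewrite circular_d_v. unfold inner, x1, x2, x3; cbn.
    pose proof (cos_sq v). nra.
  - rewrite (circular_d_u _ _ _ _ H r v Ir), circular_d_v. fold m.
    assert (E : inner
     (add3 (scal3 1 (m + cos v, sin v, sigma / (1 - r ^ 2)))
        (scal3 (m * sin v / r) (- r * sin v, r * cos v, 0)))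
     (add3 (scal3 1 (m + cos v, sin v, sigma / (1 - r ^ 2)))
        (scal3 (m * sin v / r) (- r * sin v, r * cos v, 0)))
      = ((1 - r ^ 2 - sigma * r ^ 2 * cos v) ^ 2 - 1) * (/ (1 - r ^ 2)) ^ 2).
    { unfold inner, add3, scal3, x1, x2, x3; cbn [fst snd].
      assert (Q : sin v ^ 2 = 1 - cos v ^ 2) by (pose proof (cos_sq v); lra).
      unfold m; destruct (profile_sign H) as [-> | ->]; field [Q]; split; (lra || nonzero N). }
    rewrite E.
    assert (0 < (/ (1 - r ^ 2)) ^ 2) by (apply pow2_gt_0, Rinv_neq_0_compat, N).
    assert ((1 - r ^ 2 - sigma * r ^ 2 * cos v) ^ 2 - 1 < 0) by nra.
    nra.
Qed.

(** * Membership in the Riemann family *)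

(** For [lambda = -2] the radicand is the perfect square [q * (1 - q) ^ 2], with root
    [r * (sigma * (1 - r ^ 2))]. The rest is the chain rule for [q = r ^ 2]. *)
Lemma circular_family sigma I c z (D : R -> R -> Prop)
    (H : riemann_profile sigma I c z) :
  (forall r v, D r v -> I r) -> riemann_family_member (-2) (circular c z) D.
Proof.
  intros HD. exists (fun q => - c (sqrt q)), (fun q => z (sqrt q)). intros r v Drv q P.
  pose proof (HD r v Drv) as Ir.
  pose proof (profile_nonzero _ _ _ _ H r Ir) as N. pose proof (profile_pos H r Ir) as Pr.
  pose proof (profile_side H r Ir) as S.
  assert (Eq : sqrt q = r) by (apply sqrt_pow2; lra).
  assert (Pq : 0 < q) by (apply pow_lt; exact Pr).
  assert (EP : P = (r * (sigma * (1 - r ^ 2))) ^ 2).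
  { unfold P, q. destruct (profile_sign H) as [-> | ->]; ring. }
  assert (Pp : 0 < r * (sigma * (1 - r ^ 2))) by (apply Rmult_lt_0_compat; assumption).
  assert (ES : sqrt P = r * (sigma * (1 - r ^ 2))) by (rewrite EP; apply sqrt_pow2; lra).
  assert (Ds : is_derive sqrt q (/ (2 * r))).
  { rewrite <- Eq. auto_derive; [exact Pq|field]. rewrite Eq. lra. }
  pose proof (profile_derive H r Ir) as Dz.
  pose proof (profile_center_derive _ _ _ _ H r Ir) as Dc.
  split; [exact Pr|]. split; [rewrite EP; apply pow_lt, Pp|].
  rewrite ES. split; [|split].
  - replace (1 / _) with (/ (2 * r) * (sigma / (1 - r ^ 2))).
    + apply (is_derive_comp z sqrt); [rewrite Eq; exact Dz|exact Ds].
    + destruct (profile_sign H) as [-> | ->]; field; split; (lra || nonzero N).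
  - replace (q / _) with (- (/ (2 * r) * (- sigma * r ^ 2 / (1 - r ^ 2)))).
    + apply (is_derive_opp (fun q => c (sqrt q))).
      apply (is_derive_comp c sqrt); [rewrite Eq; exact Dc|exact Ds].
    + unfold q. destruct (profile_sign H) as [-> | ->]; field; split; (lra || nonzero N).
  - unfold circular. rewrite Eq, Ropp_involutive. reflexivity.
Qed.

(** * Foliation by circles *)

(** The angle is [acos a] or its opposite, according to the sign of [b]. In this half-open range the
    cosine is -1 at [PI] only. *)
Lemma angle_exists a b :
  a * a + b * b = 1 -> exists v, - PI < v <= PI /\ cos v = a /\ sin v = b.
Proof.
  intros E. assert (Ha : -1 <= a <= 1) by nra.
  pose proof (acos_bound a) as B. pose proof PI_RGT_0 as Pp.
  pose proof (cos_acos a Ha) as C. pose proof (sin_acos a Ha) as S.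
  assert (Q : 1 - Rsqr a = Rsqr b) by (unfold Rsqr; lra). rewrite Q, sqrt_Rsqr_abs in S.
  destruct (Rle_lt_dec 0 b) as [Hb | Hb].
  - exists (acos a). rewrite Rabs_right in S by lra. repeat split; lra || assumption.
  - exists (- acos a). rewrite cos_neg, sin_neg, S, Rabs_left by exact Hb.
    assert (acos a <> PI).
    { intros F. rewrite F, cos_PI in C. rewrite <- C in E. nra. }
    repeat split; lra || assumption.
Qed.

(** [exp (2 * z r)] is a nonconstant Moebius function of [r], hence injective. *)
Lemma profile_injective sigma I c z (H : riemann_profile sigma I c z) r s :
  I r -> I s -> z r = z s -> r = s.
Proof.
  intros Ir Is E.
  pose proof (profile_exp H r Ir) as Er. pose proof (profile_exp H s Is) as Es.
  rewrite E in Er. set (e := exp (2 * z s)) in *.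
  assert (Q : (sigma + r) * (1 - sigma * s) = (sigma + s) * (1 - sigma * r)).
  { rewrite <- Er, <- Es. ring. }
  destruct (profile_sign H) as [-> | ->]; lra.
Qed.

(** The height determines the radius, so each level set lies on a single circle, where bounds on
    [cos v] cut out an open subset. [J] is the actual range of radii, which need not be open. *)
Lemma circular_foliated sigma I c z (J : R -> Prop) (lo hi : R -> R) (D : R -> R -> Prop)
    (H : riemann_profile sigma I c z) :
  (forall r, J r -> I r) ->
  (forall r v, D r v -> J r /\ lo r < cos v < hi r) ->
  (forall r a b, J r -> lo r < a < hi r -> a * a + b * b = 1 ->
     exists v, D r v /\ cos v = a /\ sin v = b) ->
  foliated_by_circles_in_spacelike_planes (image (circular c z) D).
Proof.
  intros JI HD Hv. exists (0, 0, 1). split.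
  { intros [[a b] d] Np. unfold inner, x1, x2, x3; cbn. intros E.
    assert (d = 0) by lra. subst d.
    destruct (Req_dec a 0) as [-> | Na]; [|nra].
    destruct (Req_dec b 0) as [-> | Nb]; [|nra]. contradiction Np. reflexivity. }
  intros h ([[p1 p2] p3] & Ip & Ep). split; [exists (p1, p2, p3); split; assumption|].
  destruct Ip as (r & v & Drv & Exp).
  destruct (HD r v Drv) as [Jr _]. pose proof (profile_pos H r (JI r Jr)) as Pr.
  (* The metric is negative along [x3], hence the sign. *)
  assert (Eh : h = - z r).
  { rewrite <- Ep, Exp. unfold inner, circular, add3, scal3, x1, x2, x3; cbn. ring. }
  exists (c r, 0, z r), r.
  assert (Same : forall q, image (circular c z) D q -> inner (0, 0, 1) q = h ->
    exists w, D r w /\ q = circular c z r w).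
  { intros q (s & w & Dsw & ->) E.
    assert (s = r); [|subst s; exists w; split; trivial].
    apply (profile_injective _ _ _ _ H); [apply JI, (HD s w Dsw)|apply JI, Jr|].
    unfold inner, circular, add3, scal3, x1, x2, x3 in E; cbn in E. lra. }
  split; [|split; [exact Pr|split]].
  - rewrite Eh. unfold inner, x1, x2, x3; cbn. ring.
  - intros q [Iq Eq]. split; [exact Eq|].
    destruct (Same q Iq Eq) as (w & _ & ->).
    unfold inner, sub3, circular, add3, scal3, x1, x2, x3; cbn [fst snd].
    assert (Q : sin w ^ 2 = 1 - cos w ^ 2) by (pose proof (cos_sq w); lra).
    ring [Q].
  - intros q [Iq Eq]. destruct (Same q Iq Eq) as (w & Drw & ->).
    destruct (HD r w Drw) as [_ [L U]].
    (* On the circle [x1 = c r + r * cos v], so a change of [x1] below this minimum keeps the cosine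
       between [lo r] and [hi r]. *)
    assert (Ppos : 0 < Rmin (r * (cos w - lo r)) (r * (hi r - cos w))).
    { apply Rmin_glb_lt; apply Rmult_lt_0_compat; lra. }
    exists (mkposreal _ Ppos). intros [[q1 q2] q3] [Eq3 Cq] B1 _ _.
    unfold inner, sub3, circular, add3, scal3, x1, x2, x3 in Cq, Eq3, B1, Eq |- *;
      cbn in Cq, Eq3, B1, Eq |- *.
    assert (q3 = z r) by lra. subst q3.
    assert (Pr1 := Rmin_l (r * (cos w - lo r)) (r * (hi r - cos w))).
    assert (Pr2 := Rmin_r (r * (cos w - lo r)) (r * (hi r - cos w))).
    apply Rabs_def2 in B1.
    destruct (Hv r ((q1 - c r) / r) (q2 / r)) as (t & Drt & Ct & St).
    + exact Jr.
    + split.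
      * apply Rmult_lt_reg_l with r; [exact Pr|].
        replace (r * ((q1 - c r) / r)) with (q1 - c r) by (field; lra). lra.
      * apply Rmult_lt_reg_l with r; [exact Pr|].
        replace (r * ((q1 - c r) / r)) with (q1 - c r) by (field; lra). lra.
    + apply Rmult_eq_reg_l with (r * r); [|nra].
      transitivity ((q1 - c r) ^ 2 + q2 ^ 2); [field|]; lra.
    + split; [|lra]. exists r, t. split; [exact Drt|].
      unfold circular, add3, scal3, x1, x2, x3; cbn. rewrite Ct, St.
      apply L3_eq; field; lra.
Qed.

(** * Velocity fields of rotation groups *)

(** Polarization, with no regularity assumed on [K]: comparing [p] with the origin and with each
    basis vector expresses every coordinate of [K p] affinely in [p]. Comparing these four points
    with each other gives the skew symmetry of the linear part. *)
Lemma infinitesimal_isometry_affine (K : L3 -> L3) :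
  (forall p q, inner (sub3 (K p) (K q)) (sub3 p q) = 0) ->
  exists al be ga b1 b2 b3, forall p,
    K p = (al * x2 p + be * x3 p + b1, - al * x1 p + ga * x3 p + b2,
           be * x1 p + ga * x2 p + b3).
Proof.
  intros HK.
  set (o := (0, 0, 0) : L3). set (e1 := (1, 0, 0) : L3).
  set (e2 := (0, 1, 0) : L3). set (e3 := (0, 0, 1) : L3).
  exists (x1 (K e2) - x1 (K o)), (x1 (K e3) - x1 (K o)), (x2 (K e3) - x2 (K o)),
    (x1 (K o)), (x2 (K o)), (x3 (K o)).
  intros p.
  pose proof (HK p o) as P0. pose proof (HK p e1) as P1.
  pose proof (HK p e2) as P2. pose proof (HK p e3) as P3.
  pose proof (HK e1 o) as Q1. pose proof (HK e2 o) as Q2. pose proof (HK e3 o) as Q3.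
  pose proof (HK e1 e2) as Q12. pose proof (HK e1 e3) as Q13. pose proof (HK e2 e3) as Q23.
  destruct (K p) as [[k1 k2] k3], (K o) as [[o1 o2] o3], (K e1) as [[f11 f12] f13],
    (K e2) as [[f21 f22] f23], (K e3) as [[f31 f32] f33], p as [[p1 p2] p3].
  unfold o, e1, e2, e3, inner, sub3, add3, scal3, x1, x2, x3 in *; cbn in *.
  assert (f11 = o1) by lra. assert (f22 = o2) by lra. assert (f33 = o3) by lra.
  subst f11 f22 f33.
  assert (f12 - o2 = - (f21 - o1)) by lra.
  assert (f13 - o3 = f31 - o1) by lra.
  assert (f23 - o3 = f32 - o2) by lra.
  replace f12 with (o2 - (f21 - o1)) in * by lra.
  replace f13 with (o3 + (f31 - o1)) in * by lra.
  replace f23 with (o3 + (f32 - o2)) in * by lra.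
  apply L3_eq; lra.
Qed.

Definition velocity (phi : R -> L3 -> L3) (p : L3) : L3 :=
  (Derive (fun s => x1 (phi s p)) 0, Derive (fun s => x2 (phi s p)) 0,
   Derive (fun s => x3 (phi s p)) 0).

(** The squared interval between [phi s p] and [phi s q] is constant in [s]; its derivative at 0 is
    twice the product below. *)
Lemma velocity_killing phi (H : rotation_group phi) p q :
  inner (sub3 (velocity phi p) (velocity phi q)) (sub3 p q) = 0.
Proof.
  destruct H as (H0 & _ & Hiso & Hd & _).
  destruct (Hd 0 p) as (P1 & P2 & P3), (Hd 0 q) as (Q1 & Q2 & Q3).
  set (N := fun s => inner (sub3 (phi s p) (phi s q)) (sub3 (phi s p) (phi s q))).
  assert (D0 : is_derive N 0 0).
  { apply is_derive_ext with (fun _ => inner (sub3 p q) (sub3 p q)).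
    - intros s. symmetry. apply (Hiso s).
    - exact (is_derive_const (K := R_AbsRing) (V := R_NormedModule) _ 0). }
  assert (Sq : forall f g : R -> R, ex_derive f 0 -> ex_derive g 0 ->
    is_derive (fun s => (f s + -1 * g s) * (f s + -1 * g s)) 0
      (2 * (Derive f 0 - Derive g 0) * (f 0 - g 0))).
  { intros f g Ef Eg. auto_derive; [repeat split; assumption|].
    change (fun x => f x) with f. change (fun x => g x) with g. ring. }
  assert (D1 : is_derive N 0
    (2 * inner (sub3 (velocity phi p) (velocity phi q)) (sub3 p q))).
  { pose proof (is_derive_minus _ _ _ _ _ (is_derive_plus _ _ _ _ _
      (Sq _ _ P1 Q1) (Sq _ _ P2 Q2)) (Sq _ _ P3 Q3)) as DN.
    cbn beta in DN. rewrite !H0 in DN.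
    replace (2 * _) with
      (2 * (Derive (fun s => x1 (phi s p)) 0 - Derive (fun s => x1 (phi s q)) 0) * (x1 p - x1 q) +
       2 * (Derive (fun s => x2 (phi s p)) 0 - Derive (fun s => x2 (phi s q)) 0) * (x2 p - x2 q) +
       - (2 * (Derive (fun s => x3 (phi s p)) 0 - Derive (fun s => x3 (phi s q)) 0) * (x3 p - x3 q))).
    - exact DN.
    - unfold velocity, inner, sub3, add3, scal3. unfold x1, x2, x3; cbn [fst snd]. ring. }
  apply is_derive_unique in D0. apply is_derive_unique in D1. lra.
Qed.

(** By the group law, the velocity of an orbit at time [s] is the velocity field at [phi s p]. If
    the field vanished, all orbits would be constant, against the nontriviality clause. *)
Lemma rotation_velocity_nonzero phi (H : rotation_group phi) :
  ~ (forall p, velocity phi p = (0, 0, 0)).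
Proof.
  destruct H as (H0 & Hadd & _ & Hd & _ & (t & p & Hne)). intros Z. apply Hne.
  assert (Zc : forall s, is_derive (fun t => x1 (phi t p)) s 0 /\
    is_derive (fun t => x2 (phi t p)) s 0 /\ is_derive (fun t => x3 (phi t p)) s 0).
  { intros s. destruct (Hd 0 (phi s p)) as (P1 & P2 & P3).
    pose proof (Z (phi s p)) as Zs. injection Zs as Z1 Z2 Z3.
    assert (Shift : forall f : L3 -> R,
      ex_derive (fun h => f (phi h (phi s p))) 0 ->
      Derive (fun h => f (phi h (phi s p))) 0 = 0 ->
      is_derive (fun t => f (phi t p)) s 0).
    { intros f Ex Ez.
      apply is_derive_ext with (fun t => f (phi (t - s) (phi s p))).
      - intros u. rewrite <- Hadd. do 2 f_equal. ring.
      - replace 0 with (1 * 0) by ring.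
        apply (is_derive_comp (fun h => f (phi h (phi s p))) (fun t => t - s)).
        + replace (s - s) with 0 by ring. rewrite <- Ez at 2. apply Derive_correct, Ex.
        + auto_derive; trivial. }
    split; [|split]; apply Shift; assumption. }
  assert (Const : forall f : R -> R, (forall s, is_derive f s 0) -> f t = f 0).
  { intros f Df. destruct (MVT_gen f 0 t (fun _ => 0)) as (w & _ & Ew).
    - intros s _. apply Df.
    - intros s _. apply continuity_pt_filterlim. apply (ex_derive_continuous f s).
      eexists. apply Df.
    - lra. }
  pose proof (Const _ (fun s => proj1 (Zc s))) as C1.
  pose proof (Const _ (fun s => proj1 (proj2 (Zc s)))) as C2.
  pose proof (Const _ (fun s => proj2 (proj2 (Zc s)))) as C3.
  cbn beta in C1, C2, C3. rewrite !H0 in C1, C2, C3.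
  destruct (phi t p) as [[a b] d], p as [[a' b'] d'].
  apply L3_eq; assumption.
Qed.

(** * Implicit equation and tangency condition *)

(** With [w = x1 + x3] the surface lies in the zero set of
    [(e^{2 x3} + sigma) (w^2 + x2^2) - 2 (e^{2 x3} - sigma) w]. *)
Lemma circular_implicit sigma I c z (H : riemann_profile sigma I c z) r v p :
  I r -> p = circular c z r v ->
  (exp (2 * x3 p) + sigma) * ((x1 p + x3 p) ^ 2 + x2 p ^ 2) -
  2 * (exp (2 * x3 p) - sigma) * (x1 p + x3 p) = 0.
Proof.
  intros Ir ->. pose proof (profile_nonzero _ _ _ _ H r Ir) as N.
  pose proof (profile_exp H r Ir) as Ez.
  unfold circular, add3, scal3, x1, x2, x3; cbn [fst snd].
  replace (z r + r * 0) with (z r) by ring. rewrite (profile_center H r).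
  set (e := exp (2 * z r)) in *.
  assert (S : 1 - sigma * r <> 0).
  { intros F. apply N. destruct (profile_sign H) as [-> | ->].
    - replace r with 1 by lra. ring.
    - replace r with (-1) by lra. ring. }
  assert (Ee : e = (sigma + r) / (1 - sigma * r)) by (rewrite <- Ez; field; exact S).
  assert (Q : sin v ^ 2 = 1 - cos v ^ 2) by (pose proof (cos_sq v); lra).
  rewrite Ee. destruct (profile_sign H) as [-> | ->]; field [Q]; nonzero S.
Qed.

(** The implicit function vanishes along [g] near 0, so its derivative there is zero. This
    derivative is a nonzero multiple of the claimed expression. *)
Lemma circular_tangency sigma I c z (H : riemann_profile sigma I c z)
    (D : R -> R -> Prop) (g : R -> L3) k1 k2 k3 r v :
  (forall r v, D r v -> I r) -> I r -> g 0 = circular c z r v ->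
  is_derive (fun s => x1 (g s)) 0 k1 -> is_derive (fun s => x2 (g s)) 0 k2 ->
  is_derive (fun s => x3 (g s)) 0 k3 ->
  locally 0 (fun s => image (circular c z) D (g s)) ->
  cos v * (k1 + k3) + sin v * k2 - (1 - r ^ 2) * (sigma + cos v) * k3 = 0.
Proof.
  intros DI Ir g0 D1 D2 D3 Hl.
  pose proof (profile_nonzero _ _ _ _ H r Ir) as N. pose proof (profile_pos H r Ir) as Pr.
  pose proof (profile_exp H r Ir) as Ez.
  set (F := fun s => (exp (2 * x3 (g s)) + sigma) * ((x1 (g s) + x3 (g s)) ^ 2 + x2 (g s) ^ 2) -
     2 * (exp (2 * x3 (g s)) - sigma) * (x1 (g s) + x3 (g s))).
  assert (F0 : is_derive F 0 0).
  { apply is_derive_ext_loc with (fun _ => 0); [|auto_derive; trivial].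
    revert Hl. apply filter_imp. intros s (a & b & Dab & E). symmetry.
    apply (circular_implicit _ _ _ _ H a b); [apply (DI a b Dab)|exact E]. }
  set (e := exp (2 * x3 (g 0))). set (w := x1 (g 0) + x3 (g 0)). set (y := x2 (g 0)).
  assert (F1 : is_derive F 0
    (2 * e * k3 * (w ^ 2 + y ^ 2) + (e + sigma) * (2 * w * (k1 + k3) + 2 * y * k2)
     - 4 * e * k3 * w - 2 * (e - sigma) * (k1 + k3))).
  { unfold F, e, w, y.
    (* Abstracting the coordinates of [g] lets [auto_derive] treat them as opaque functions. *)
    assert (Gen : forall f1 f2 f3 : R -> R,
      is_derive f1 0 k1 -> is_derive f2 0 k2 -> is_derive f3 0 k3 ->
      is_derive (fun s => (exp (2 * f3 s) + sigma) * ((f1 s + f3 s) ^ 2 + f2 s ^ 2) -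
        2 * (exp (2 * f3 s) - sigma) * (f1 s + f3 s)) 0
       (2 * exp (2 * f3 0) * k3 * ((f1 0 + f3 0) ^ 2 + f2 0 ^ 2)
        + (exp (2 * f3 0) + sigma) * (2 * (f1 0 + f3 0) * (k1 + k3) + 2 * f2 0 * k2)
        - 4 * exp (2 * f3 0) * k3 * (f1 0 + f3 0)
        - 2 * (exp (2 * f3 0) - sigma) * (k1 + k3))).
    { intros f1 f2 f3 E1 E2 E3. auto_derive.
      - repeat split; eexists; eassumption.
      - change (fun x => f1 x) with f1. change (fun x => f2 x) with f2.
        change (fun x => f3 x) with f3.
        rewrite (is_derive_unique _ _ _ E1), (is_derive_unique _ _ _ E2),
          (is_derive_unique _ _ _ E3). ring. }
    exact (Gen _ _ _ D1 D2 D3). }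
  apply is_derive_unique in F0. rewrite (is_derive_unique _ _ _ F1) in F0. clear F1.
  assert (E3 : x3 (g 0) = z r) by (rewrite g0; unfold x3; cbn; ring).
  assert (Ew : w = sigma * r + r * cos v).
  { unfold w. rewrite E3, g0. unfold circular, x1; cbn. rewrite (profile_center H r). ring. }
  assert (Ey : y = r * sin v) by (unfold y; rewrite g0; unfold x2; cbn; ring).
  assert (S : 1 - sigma * r <> 0).
  { intros G. apply N. destruct (profile_sign H) as [-> | ->].
    - replace r with 1 by lra. ring.
    - replace r with (-1) by lra. ring. }
  assert (Ee : e = (sigma + r) / (1 - sigma * r)).
  { unfold e. rewrite E3, <- Ez. field. exact S. }
  rewrite Ew, Ey, Ee in F0.
  assert (Q : sin v ^ 2 = 1 - cos v ^ 2) by (pose proof (cos_sq v); lra).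
  (* The factor comes from [e + sigma = 2 * sigma / (1 - sigma * r)] and
     [e - sigma = 2 * r / (1 - sigma * r)]. *)
  apply Rmult_eq_reg_l with (4 * r * sigma / (1 - sigma * r)).
  - rewrite Rmult_0_r. refine (eq_trans _ F0).
    destruct (profile_sign H) as [-> | ->]; field [Q]; nonzero S.
  - apply Rmult_integral_contrapositive. split; [|apply Rinv_neq_0_compat, S].
    destruct (profile_sign H) as [-> | ->]; lra.
Qed.

(** * Absence of infinitesimal symmetries *)

(** Three equally spaced points suffice: the second difference isolates [A], then the first
    difference isolates [B]. *)
Lemma quadratic_zero A B C lo hi :
  lo < hi -> (forall a, lo < a < hi -> A * a ^ 2 + B * a + C = 0) ->
  A = 0 /\ B = 0 /\ C = 0.
Proof.
  intros L P. set (d := (hi - lo) / 4). set (m := (lo + hi) / 2).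
  assert (Pd : 0 < d) by (unfold d; lra).
  pose proof (P m) as P0. pose proof (P (m - d)) as P1. pose proof (P (m + d)) as P2.
  specialize (P0 ltac:(unfold m, d; lra)). specialize (P1 ltac:(unfold m, d; lra)).
  specialize (P2 ltac:(unfold m, d; lra)). clearbody m d.
  assert (A0 : A = 0).
  { apply Rmult_eq_reg_r with (d ^ 2); [lra|]. apply pow_nonzero. lra. }
  subst A.
  assert (B0 : B = 0).
  { apply Rmult_eq_reg_r with d; lra. }
  subst B. lra.
Qed.

(** For fixed [r] the condition on [v] involves only its cosine, so [v] and [- v] are both
    available. The even part of the relation is quadratic in [cos v], and the odd part is [sin v]
    times a polynomial of degree one in [cos v]. *)
Lemma circular_no_killing sigma I c z (H : riemann_profile sigma I c z)
    al be ga b1 b2 b3 r1 r2 (lo hi : R -> R) :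
  r1 < r2 -> (forall r, r1 < r < r2 -> I r /\ -1 <= lo r /\ lo r < hi r /\ hi r <= 1) ->
  (forall r v, r1 < r < r2 -> lo r < cos v < hi r ->
     let p := circular c z r v in
     let k1 := al * x2 p + be * x3 p + b1 in
     let k2 := - al * x1 p + ga * x3 p + b2 in
     let k3 := be * x1 p + ga * x2 p + b3 in
     cos v * (k1 + k3) + sin v * k2 - (1 - r ^ 2) * (sigma + cos v) * k3 = 0) ->
  al = 0 /\ be = 0 /\ ga = 0 /\ b1 = 0 /\ b2 = 0 /\ b3 = 0.
Proof.
  intros L12 Hr HT.
  assert (Coef : forall r, r1 < r < r2 ->
    be = 0 /\ ga = 0 /\ b1 = 0 /\ b3 = 0 /\ - al * c r + b2 = 0).
  { intros r Br. destruct (Hr r Br) as (Ir & L1 & L2 & L3').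
    pose proof (profile_nonzero _ _ _ _ H r Ir) as N. pose proof (profile_pos H r Ir) as Pr.
    assert (Eq : forall v, lo r < cos v < hi r ->
      cos v * (al * (r * sin v) + be * z r + b1)
      + sin v * (- al * (c r + r * cos v) + ga * z r + b2)
      + (be * (c r + r * cos v) + ga * (r * sin v) + b3)
        * (r ^ 2 * cos v - (1 - r ^ 2) * sigma) = 0).
    { intros v Bv. rewrite <- (HT r v Br Bv).
      unfold circular, x1, x2, x3; cbn. ring. }
    destruct (quadratic_zero (be * r ^ 3)
      (be * z r + b1 + (be * c r + b3) * r ^ 2 - be * r * (1 - r ^ 2) * sigma)
      (- (be * c r + b3) * (1 - r ^ 2) * sigma) (lo r) (hi r) L2) as (A1 & A2 & A3).
    { intros a Ba. pose proof (cos_acos a ltac:(lra)) as Ca.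
      pose proof (Eq (acos a) ltac:(lra)) as E1.
      pose proof (Eq (- acos a) ltac:(rewrite cos_neg; lra)) as E2.
      rewrite cos_neg, sin_neg, Ca in E2. rewrite Ca in E1. lra. }
    (* The odd part, after division by [sin v], which is positive at [acos a] because [a] lies
       strictly between -1 and 1. *)
    destruct (quadratic_zero 0 (ga * r ^ 3)
      (- al * c r + ga * z r + b2 - ga * r * (1 - r ^ 2) * sigma) (lo r) (hi r) L2)
      as (_ & A4 & A5).
    { intros a Ba. pose proof (cos_acos a ltac:(lra)) as Ca.
      pose proof (Eq (acos a) ltac:(lra)) as E1.
      pose proof (Eq (- acos a) ltac:(rewrite cos_neg; lra)) as E2.
      rewrite cos_neg, sin_neg, Ca in E2. rewrite Ca in E1.
      assert (Sp : 0 < sin (acos a)).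
      { rewrite sin_acos by lra. apply sqrt_lt_R0. unfold Rsqr. nra. }
      apply Rmult_eq_reg_l with (sin (acos a)); lra. }
    assert (R3 : r ^ 3 <> 0) by (apply pow_nonzero; lra).
    assert (be = 0) by (apply Rmult_eq_reg_r with (r ^ 3); lra). subst be.
    assert (ga = 0) by (apply Rmult_eq_reg_r with (r ^ 3); lra). subst ga.
    assert (b3 = 0).
    { apply Rmult_eq_reg_r with (sigma * (1 - r ^ 2)); [lra|].
      pose proof (profile_side H r Ir). lra. }
    subst b3. repeat split; lra. }
  set (r := (r1 + r2) / 2). assert (Br : r1 < r < r2) by (unfold r; lra).
  destruct (Coef r Br) as (-> & -> & -> & -> & Cr). destruct (Hr r Br) as (Ir & _).
  pose proof (profile_nonzero _ _ _ _ H r Ir) as N. pose proof (profile_pos H r Ir) as Pr.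
  (* What remains says that [al * c] is constant, while the derivative of [c] does not vanish. *)
  assert (D0 : is_derive (fun t => al * c t) r 0).
  { apply is_derive_ext_loc with (fun _ => b2); [|auto_derive; trivial].
    apply (filter_imp (fun t => r1 < t < r2)).
    - intros t Bt. destruct (Coef t Bt) as (_ & _ & _ & _ & Ct). cbn. lra.
    - apply (open_and _ _ (open_gt r1) (open_lt r2)). exact Br. }
  assert (D1 : is_derive (fun t => al * c t) r (al * (- sigma * r ^ 2 / (1 - r ^ 2)))).
  { apply (is_derive_scal c r al), (profile_center_derive _ _ _ _ H r Ir). }
  apply is_derive_unique in D0. apply is_derive_unique in D1. rewrite D0 in D1.
  assert (al = 0).
  { apply Rmult_eq_reg_r with (- sigma * r ^ 2 / (1 - r ^ 2)); [lra|].
    apply Rmult_integral_contrapositive. split; [|apply Rinv_neq_0_compat, N].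
    destruct (profile_sign H) as [-> | ->]; nra. }
  subst al. repeat split; lra.
Qed.

(** Parameters in [D] may be confined to one period, so interiority is asked only of some [w] giving
    the same point as [v]. *)
Lemma circular_not_rotational sigma I c z (H : riemann_profile sigma I c z)
    (D : R -> R -> Prop) r1 r2 (lo hi : R -> R) :
  (forall r v, D r v -> I r) ->
  r1 < r2 -> (forall r, r1 < r < r2 -> I r /\ -1 <= lo r /\ lo r < hi r /\ hi r <= 1) ->
  (forall r v, r1 < r < r2 -> lo r < cos v < hi r ->
     exists w, cos w = cos v /\ sin w = sin v /\ locally_2d D r w) ->
  ~ rotational (circular c z) D.
Proof.
  intros DI L12 Hr HD (phi & Hphi & Hinv).
  destruct (infinitesimal_isometry_affine (velocity phi) (velocity_killing phi Hphi))
    as (al & be & ga & b1 & b2 & b3 & HK).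
  apply (rotation_velocity_nonzero phi Hphi).
  destruct (circular_no_killing sigma I c z H al be ga b1 b2 b3 r1 r2 lo hi L12 Hr)
    as (-> & -> & -> & -> & -> & ->).
  - intros r v Br Bv. destruct (HD r v Br Bv) as (w & Cw & Sw & Lw).
    destruct (Hinv r w Lw) as [eps He].
    assert (Ew : circular c z r w = circular c z r v)
      by (unfold circular; rewrite Cw, Sw; reflexivity).
    rewrite Ew in He.
    destruct Hphi as (H0 & _ & _ & Hd & _).
    destruct (Hd 0 (circular c z r v)) as (E1 & E2 & E3).
    pose proof (HK (circular c z r v)) as K.
    apply (circular_tangency sigma I c z H D (fun s => phi s (circular c z r v))).
    + exact DI.
    + apply (Hr r Br).
    + apply H0.
    + evar_last; [exact (Derive_correct _ _ E1)|exact (f_equal x1 K)].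
    + evar_last; [exact (Derive_correct _ _ E2)|exact (f_equal x2 K)].
    + evar_last; [exact (Derive_correct _ _ E3)|exact (f_equal x3 K)].
    + exists eps. intros t Bt. apply He.
      change (Rabs (t - 0) < eps) in Bt. rewrite Rminus_0_r in Bt. exact Bt.
  - intros p. rewrite HK. apply L3_eq; ring.
Qed.

(** * The two explicit profiles *)

Lemma exp_two_half_ln y : 0 < y -> exp (2 * (/ 2 * ln y)) = y.
Proof.
  intros Hy. replace (2 * (/ 2 * ln y)) with (ln y) by field. apply exp_ln, Hy.
Qed.

Lemma locally_2d_snd (J : R -> Prop) (u v : R) :
  locally v J -> locally_2d (fun _ b => J b) u v.
Proof.
  intros [eps He]. exists eps. intros a b _ Hb. apply He. exact Hb.
Qed.

Lemma locally_open_interval a b x :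
  a < x < b -> locally x (fun t => a < t < b).
Proof.
  intros Hx. apply (open_and _ _ (open_gt a) (open_lt b)). exact Hx.
Qed.

Lemma continuity_2d_pt_locally_pos f u v :
  continuity_2d_pt f u v -> 0 < f u v -> locally_2d (fun a b => 0 < f a b) u v.
Proof.
  intros Cf Pf. destruct (Cf (mkposreal _ Pf)) as [d Hd]. exists d.
  intros a b Ha Hb. specialize (Hd a b Ha Hb). apply Rabs_def2 in Hd. cbn in Hd. lra.
Qed.

Lemma outer_profile :
  riemann_profile (-1) (fun r => 1 < r)
    (fun r => - r - / 2 * ln ((r - 1) / (r + 1))) (fun r => / 2 * ln ((r - 1) / (r + 1))).
Proof.
  assert (Q : forall r, 1 < r -> 0 < (r - 1) / (r + 1)).
  { intros r Hr. apply Rdiv_lt_0_compat; lra. }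
  split.
  - right. reflexivity.
  - intros r Hr. apply (open_gt 1). exact Hr.
  - intros r Hr. lra.
  - intros r Hr. nra.
  - intros r. ring.
  - intros r Hr. auto_derive.
    + split; [lra|]. split; [apply Q, Hr|trivial].
    + field. repeat split; nra.
  - intros r Hr. rewrite exp_two_half_ln by (apply Q, Hr). field. lra.
Qed.

Lemma inner_profile :
  riemann_profile 1 (fun r => 0 < r < 1) (fun r => r - artanh r) artanh.
Proof.
  assert (Q : forall r, 0 < r < 1 -> 0 < (1 + r) / (1 - r)).
  { intros r Hr. apply Rdiv_lt_0_compat; lra. }
  split.
  - left. reflexivity.
  - intros r. apply locally_open_interval.
  - intros r Hr. lra.
  - intros r Hr. nra.
  - intros r. ring.
  - intros r Hr. unfold artanh. auto_derive.
    + split; [lra|]. split; [apply Q, Hr|trivial].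
    + field. repeat split; nra.
  - intros r Hr. unfold artanh. rewrite exp_two_half_ln by (apply Q, Hr). field. lra.
Qed.

(** * The outer surface *)

(** Clearing the denominator turns the bound into positivity of a continuous function, as needed for
    openness, and into the inequality [-1 < W] of the timelike criterion. *)
Lemma outer_bound_iff r y : 1 < r -> 1 - 2 / r ^ 2 < y <-> 0 < 2 - r * r * (1 - y).
Proof.
  intros Hr.
  assert (E : 2 - r * r * (1 - y) = (r * r) * (y - (1 - 2 / r ^ 2))) by (field; lra).
  rewrite E. split; intros L.
  - apply Rmult_lt_0_compat; nra.
  - assert (0 < y - (1 - 2 / r ^ 2)); [|lra].
    apply Rmult_lt_reg_l with (r * r); nra.
Qed.

(** The strict [r0 < r] avoids the boundary circle of the domain; the cosine bounds are open
    conditions. *)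
Lemma D_outer_interior r0 r v :
  1 < r0 -> r0 < r -> 1 - 2 / r ^ 2 < cos v < 1 -> locally_2d (D_outer r0) r v.
Proof.
  intros H0 Hr [L U].
  assert (A : locally_2d (fun a _ => r0 < a) r v).
  { apply (locally_2d_fst (fun a => r0 < a)), (open_gt r0), Hr. }
  assert (Ccos : continuity_2d_pt (fun _ b => cos b) r v).
  { apply (continuity_1d_2d_pt_comp cos (fun _ b => b)); [apply continuity_cos|].
    apply continuity_2d_pt_id2. }
  assert (C1 : continuity_2d_pt (fun _ b => 1 - cos b) r v).
  { apply (continuity_2d_pt_minus (fun _ _ => 1)); [apply continuity_2d_pt_const|exact Ccos]. }
  assert (C2 : continuity_2d_pt (fun a b => 2 - a * a * (1 - cos b)) r v).
  { apply (continuity_2d_pt_minus (fun _ _ => 2)); [apply continuity_2d_pt_const|].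
    apply (continuity_2d_pt_mult (fun a _ => a * a)); [|exact C1].
    apply (continuity_2d_pt_mult (fun a _ => a)); apply continuity_2d_pt_id1. }
  apply continuity_2d_pt_locally_pos in C1; [|lra].
  apply continuity_2d_pt_locally_pos in C2; [|apply outer_bound_iff; lra].
  pose proof (locally_2d_and _ _ _ _ A (locally_2d_and _ _ _ _ C1 C2)) as B.
  revert B. apply locally_2d_impl, locally_2d_forall.
  intros a b (Ha & B1 & B2). split; [lra|]. split; [|lra].
  apply outer_bound_iff; lra.
Qed.

Lemma outer_timelike_riemann r0 :
  1 < r0 -> timelike_riemann_zmc_spacelike_planes X_outer (D_outer r0).
Proof.
  intros H0. pose proof outer_profile as H.
  assert (DI : forall r v, D_outer r0 r v -> 1 < r) by (intros r v [Hr _]; lra).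
  split; [|split; [|split; [|split]]].
  - intros r v Drv. split.
    + apply (circular_smooth _ _ _ _ H), (DI r v Drv).
    + apply (circular_regular _ _ _ _ H), (DI r v Drv).
  - intros r v Drv. pose proof (DI r v Drv) as Hr.
    apply (circular_timelike _ _ _ _ H); [exact Hr|].
    (* With [sigma = -1], [W = 1 - r ^ 2 * (1 - cos v)]: the lower bound on [cos v] gives [-1 < W],
       the upper one [W < 1]. *)
    destruct Drv as [_ [L U]]. apply outer_bound_iff in L; [|exact Hr].
    assert (0 < r * r * (1 - cos v)) by (apply Rmult_lt_0_compat; nra). lra.
  - intros r v Drv. apply (circular_zmc _ _ _ _ H), (DI r v Drv).
  - apply (circular_not_rotational _ _ _ _ H _ r0 (r0 + 1) (fun r => 1 - 2 / r ^ 2) (fun _ => 1)).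
    + exact DI.
    + lra.
    + intros r Hr. split; [lra|].
      assert (0 < 2 / r ^ 2) by (apply Rdiv_lt_0_compat; nra).
      assert (2 / r ^ 2 <= 2); [|lra].
      apply Rmult_le_reg_r with (r ^ 2); [nra|].
      replace (2 / r ^ 2 * r ^ 2) with 2 by (field; lra). nra.
    + intros r v Hr Hv. exists v. split; [reflexivity|]. split; [reflexivity|].
      apply D_outer_interior; tauto.
  - apply (circular_foliated _ _ _ _ (fun r => r0 <= r) (fun r => 1 - 2 / r ^ 2) (fun _ => 1) _ H).
    + intros r Hr. lra.
    + intros r v Drv. exact Drv.
    + intros r a b Hr Ha E. destruct (angle_exists a b E) as (v & _ & Ca & Sb).
      exists v. split; [|split; assumption]. split; [exact Hr|]. rewrite Ca. exact Ha.
Qed.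

(** * The inner surface and its lightlike line *)

Lemma cos_gt_opp_1 v : - PI < v < PI -> -1 < cos v.
Proof.
  intros Hv. rewrite <- cos_PI. destruct (Rle_lt_dec 0 v) as [P | P].
  - apply cos_decreasing_1; lra.
  - rewrite <- (cos_neg v). apply cos_decreasing_1; lra.
Qed.

Lemma inner_angle_exists a b :
  -1 < a -> a * a + b * b = 1 -> exists v, - PI < v < PI /\ cos v = a /\ sin v = b.
Proof.
  intros Ha E. destruct (angle_exists a b E) as (v & Bv & Ca & Sb).
  exists v. split; [|split; assumption].
  assert (v <> PI); [|lra]. intros ->. rewrite cos_PI in Ca. lra.
Qed.

Lemma inner_timelike_riemann :
  timelike_riemann_zmc_spacelike_planes X_inner D_inner.
Proof.
  pose proof inner_profile as H.
  split; [|split; [|split; [|split]]].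
  - intros r v [Hr _]. split.
    + apply (circular_smooth _ _ _ _ H), Hr.
    + apply (circular_regular _ _ _ _ H), Hr.
  (* Here [W = 1 - r ^ 2 * (1 + cos v)], with [0 < 1 + cos v <= 2] and [0 < r ^ 2 < 1]. *)
  - intros r v [Hr Hv]. apply (circular_timelike _ _ _ _ H); [exact Hr|].
    pose proof (cos_gt_opp_1 v Hv). pose proof (COS_bound v) as [_ U].
    assert (0 < r ^ 2 < 1) by nra. nra.
  - intros r v [Hr _]. apply (circular_zmc _ _ _ _ H), Hr.
  - apply (circular_not_rotational _ _ _ _ H _ 0 1 (fun _ => -1) (fun _ => 1)).
    + intros r v [Hr _]. exact Hr.
    + lra.
    + intros r Hr. split; [exact Hr|]. lra.
    + intros r v Hr Hv.
      (* [v] is arbitrary here and is moved into the open period of [D_inner]. *)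
      destruct (inner_angle_exists (cos v) (sin v)) as (w & Bw & Cw & Sw).
      * lra.
      * pose proof (cos_sq v). lra.
      * exists w. split; [exact Cw|]. split; [exact Sw|].
        apply (locally_2d_and (fun a _ => 0 < a < 1) (fun _ b => - PI < b < PI)).
        -- apply (locally_2d_fst (fun a => 0 < a < 1)), locally_open_interval, Hr.
        -- apply (locally_2d_snd (fun b => - PI < b < PI)), locally_open_interval, Bw.
  (* The upper bound 2 keeps the point [cos v = 1] in the arc; each circle loses only its point with
     [cos v = -1]. *)
  - apply (circular_foliated _ _ _ _ (fun r => 0 < r < 1) (fun _ => -1) (fun _ => 2) _ H).
    + trivial.
    + intros r v [Hr Hv]. split; [exact Hr|].
      pose proof (cos_gt_opp_1 v Hv). pose proof (COS_bound v). lra.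
    + intros r a b Hr Ha E. destruct (inner_angle_exists a b (proj1 Ha) E) as (v & Bv & Cv & Sv).
      exists v. split; [|split; assumption]. split; assumption.
Qed.

(** Smoothness and regularity depend on [r] alone. Where [cos v = -1], [d_u] is a multiple of the
    null vector [(-1, 0, 1)] and is orthogonal to [d_v], and the point is [artanh r] times that
    vector. *)
Lemma inner_extends : extends_to_lightlike_line X_inner D_inner A_inner.
Proof.
  pose proof inner_profile as H.
  assert (Sin : forall v, cos v = -1 -> sin v = 0).
  { intros v Cv. pose proof (cos_sq v) as Q. rewrite Cv in Q. nra. }
  split; [|split].
  - intros r v [[Hr _] | [Hr _]].
    + split; [apply (circular_smooth _ _ _ _ H), Hr|apply (circular_regular _ _ _ _ H), Hr].
    + split; [apply (circular_smooth _ _ _ _ H), Hr|apply (circular_regular _ _ _ _ H), Hr].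
  - intros r v (Hr & _ & Cv). pose proof (Sin v Cv) as Sv.
    change X_inner with (circular (fun r => r - artanh r) artanh).
    unfold degenerate_at, tangent.
    rewrite (circular_d_u _ _ _ _ H r v Hr), circular_d_v, Cv, Sv.
    exists (- 1 ^ 2 * r ^ 2 / (1 - r ^ 2) + -1, 0, 1 / (1 - r ^ 2)). split; [|split].
    + exists 1, 0. unfold add3, scal3. apply L3_eq; cbn; lra.
    + intros E. injection E as _ E.
      assert (0 < 1 / (1 - r * (r * 1))) by (apply Rdiv_lt_0_compat; nra). lra.
    + intros w (a & b & ->). unfold inner, add3, scal3, x1, x2, x3; cbn. field. nra.
  - exists (0, 0, 0), (-1, 0, 1). split; [split|].
    + intros E. injection E. lra.
    + unfold inner, x1, x2, x3; cbn. ring.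
    + intros r v (_ & _ & Cv). exists (artanh r).
      unfold X_inner, add3, scal3. rewrite Cv, (Sin v Cv). apply L3_eq; cbn; ring.
Qed.

(** Since [M >= 0] gives [r > 0], the quotient [(1 + r) / (1 - r)] exceeds [1 / (1 - r)], which
    exceeds [exp (2 * M)]. *)
Lemma artanh_gt M r : 0 <= M -> 1 - exp (- (2 * M)) < r < 1 -> M < artanh r.
Proof.
  intros HM [L U]. unfold artanh.
  assert (E1 : exp (- (2 * M)) <= 1).
  { rewrite <- exp_0. destruct (Req_dec M 0) as [-> | N].
    - right. f_equal. ring.
    - left. apply exp_increasing. lra. }
  assert (Lt : exp (2 * M) < (1 + r) / (1 - r)).
  { apply Rmult_lt_reg_r with (1 - r); [lra|].
    replace ((1 + r) / (1 - r) * (1 - r)) with (1 + r) by (field; lra).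
    assert (E2 : exp (2 * M) * exp (- (2 * M)) = 1)
      by (rewrite <- exp_plus, Rplus_opp_r; apply exp_0).
    pose proof (exp_pos (2 * M)). nra. }
  apply ln_increasing in Lt; [|apply exp_pos]. rewrite ln_exp in Lt. lra.
Qed.

Lemma X_inner_x3 r v : x3 (X_inner r v) = artanh r.
Proof. unfold x3; cbn. ring. Qed.

Theorem theorem3p4 :
  (forall r0 : R, 1 < r0 ->
     timelike_riemann_zmc_spacelike_planes X_outer (D_outer r0) /\
     riemann_family_member (-2) X_outer (D_outer r0)) /\
  (timelike_riemann_zmc_spacelike_planes X_inner D_inner /\
   riemann_family_member (-2) X_inner D_inner /\
   extends_to_lightlike_line X_inner D_inner A_inner /\
   (forall r v : R, D_inner r v \/ A_inner r v -> 0 < x3 (X_inner r v)) /\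
   (forall v : R, - PI <= v <= PI ->
      filterlim (fun r => x3 (X_inner r v)) (at_left 1) (Rbar_locally p_infty))).
Proof.
  split.
  - intros r0 H0. split; [apply outer_timelike_riemann, H0|].
    apply (circular_family _ _ _ _ _ outer_profile). intros r v [Hr _]. lra.
  - split; [exact inner_timelike_riemann|]. split.
    { apply (circular_family _ _ _ _ _ inner_profile). intros r v [Hr _]. exact Hr. }
    split; [exact inner_extends|]. split.
    + intros r v Hrv. rewrite X_inner_x3.
      assert (Hr : 0 < r < 1) by (destruct Hrv as [[Hr _] | [Hr _]]; exact Hr).
      (* For [M = 0] the hypothesis of [artanh_gt] is just [0 < r < 1]. *)
      apply artanh_gt; [lra|]. rewrite Rmult_0_r, Ropp_0, exp_0. lra.
    (* [M] may be negative, hence the truncation [Rmax M 0]. *)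
    + intros v _ P [M HM]. exists (mkposreal _ (exp_pos (- (2 * Rmax M 0)))).
      intros r Br Lr. apply HM. rewrite X_inner_x3.
      apply Rabs_def2 in Br. cbn in Br.
      apply Rle_lt_trans with (1 := Rmax_l M 0). apply artanh_gt; [apply Rmax_r|].
      unfold minus, plus, opp in Br; cbn in Br. lra.
Qed.
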